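(* Let $r\leqslant 1$ be an odd integer coprime with $5$. Let $p$ be a prime such that $p\equiv -\frac{r}{2}\pmod{5}$ (i.e. $2p\equiv -r \pmod 5$) and $p\geqslant \frac{5-r}{2}$. Then $$\sum_{k=0}^{p-1}(10k+r)\frac{\left(\frac{r}{5}\right)_k^5}{k!^5}\equiv 0 \pmod{p^4}.$$
   Context: For a complex (here rational) number $a$ and a non-negative integer $k$, $(a)_k=a(a+1)\cdots(a+k-1)$ denotes the Pochhammer symbol, with $(a)_0=1$. The sum is a rational number whose denominator is not divisible by $p$; a congruence modulo $p^m$ between such rational numbers means their difference is $p^m$ times a rational number with denominator coprime to $p$ (equivalently, congruence in $\mathbb{Z}_p$). *)

(* Defs.v *)
From HB Require Import structures.
From mathcomp Require Import all_boot all_order all_algebra.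
Set Implicit Arguments. Unset Strict Implicit. Unset Printing Implicit Defensive.
Import Order.TTheory GRing.Theory Num.Theory.
Local Open Scope ring_scope.

Definition poch (a : rat) (k : nat) : rat := \prod_(i < k) (a + i%:R).

Definition padic_int (p : nat) (q : rat) : Prop := ~~ (p %| `|denq q|)%N.

Definition rat_congr (p m : nat) (x y : rat) : Prop :=
  exists q : rat, padic_int p q /\ x - y = (p ^ m)%:R * q.

(* Main.v *)
(* For odd p (p = 2 forces r = 1, two terms), put A = r/5, n = (3p - r)/5, so
   that A = 3p/5 - n, with n even and n < p, and for parameters u_i
   with sum 0 deform the k-th summand into
     (A + 2k) (A)_k/k! prod_(i <= 4) (A + u_i)_k/(1 - u_i)_k.
   1. For u = (p/5)(-3, 1, x, 2 - x) the deformed sum terminates at k = n and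
      vanishes exactly: up to a constant, its k-th term is Q(z_k) divided by
      prod_(j <> k) (z_k - z_j), with z_k = k(k + A) and Q a polynomial of degree
      less than n, so the sum is a divided difference of order n of Q.
   2. For u_i = p v_i, expanding the terms with k <= n modulo p^4 gives
      S0 + p^2 e2(v) S1 + p^3 e3(v) S2, where S0 is the undeformed sum and e2, e3
      are elementary symmetric functions; there is no linear term because
      e1(v) = 0.
   3. S2 = 0 mod p: as A = -n mod p with n even, k |-> n - k changes the sign of
      the summand of S2 modulo p.
   The points x = 0 and x = 1 have 25 e2 = -7 and -6, and 1 = 7 - 6 eliminates S1,
   so S0 = 0 mod p^4. The terms with n < k < p are divisible by p^5. *)
Require Import Defs.
From HB Require Import structures.
From mathcomp Require Import all_boot all_order all_algebra.
From mathcomp Require Import zify ring lra.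
Import Order.TTheory GRing.Theory Num.Theory.
Local Open Scope ring_scope.

(** * The ring of p-integral rationals *)

(** Coprimality, rather than non-divisibility by [p], makes this a subring for every [p], prime or
    not. *)
Definition p_integral (p : nat) : {pred rat} :=
  [pred x | coprime p `|denq x|].

Lemma p_integral_frac (p : nat) (a : int) (b : nat) :
  coprime p b -> (0 < b)%N -> a%:~R / b%:R \in p_integral p.
Proof.
move=> cpb b0; set x : rat := a%:~R / b%:R.
have b_neq0 : (b%:R : rat) != 0 by rewrite pnatr_eq0 -lt0n.
have e : numq x * b%:Z = a * denq x.
  apply: (@intr_inj rat); rewrite !intrM numqE /x.
  by rewrite mulrAC -[b%:Z%:~R]/(b%:R) divfK.
rewrite inE; apply: coprime_dvdr cpb.
suff : (`|denq x| %| `|numq x| * b)%N.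
  by rewrite Gauss_dvdr // coprime_sym coprime_num_den.
by rewrite -[b in (_ * b)%N]/(`|b%:Z|%N) -abszM e abszM dvdn_mull.
Qed.

Lemma p_integral_subring (p : nat) : subring_closed (p_integral p).
Proof.
have den x : (0 < `|denq x|)%N by rewrite absz_gt0 denq_neq0.
have E x : x = (numq x)%:~R / (`|denq x|%N)%:R :> rat.
  by rewrite -[X in X%:R]/(`|denq x|%N) pmulrn absz_denq divq_num_den.
split=> [|x y px py|x y px py]; first by rewrite inE (denq_int 1) coprimen1.
- have -> : x - y = (numq x * `|denq y|%N%:Z - numq y * `|denq x|%N%:Z)%:~R
       / (`|denq x| * `|denq y|)%N%:R.
    rewrite {1}(E x) {1}(E y) natrM intrD intrN !intrM -!pmulrn.
    by field; rewrite !pnatr_eq0 -!lt0n !den.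
  apply: p_integral_frac; [by rewrite coprimeMr; apply/andP|by rewrite muln_gt0 !den].
- have -> : x * y = (numq x * numq y)%:~R / (`|denq x| * `|denq y|)%N%:R.
    rewrite {1}(E x) {1}(E y) natrM intrM.
    by field; rewrite !pnatr_eq0 -!lt0n !den.
  apply: p_integral_frac; [by rewrite coprimeMr; apply/andP|by rewrite muln_gt0 !den].
Qed.

HB.instance Definition _ p :=
  GRing.isSubringClosed.Build rat (p_integral p) (p_integral_subring p).

Lemma p_integral_invr_nat (p b : nat) :
  coprime p b -> b%:R^-1 \in p_integral p.
Proof.
case: b => [|b] cpb; first by rewrite invr0 rpred0.
by rewrite -[X in X \in _]mul1r (@p_integral_frac _ 1).
Qed.

Lemma p_integral_invr_int (p : nat) (b : int) :
  coprime p `|b| -> b%:~R^-1 \in p_integral p.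
Proof.
by move=> c; case: b c => b c; rewrite ?NegzE ?rmorphN ?invrN ?rpredN
  -?pmulrn; apply: p_integral_invr_nat.
Qed.

(** With x = p q, the number 1 - x is c / [denq q] where c is congruent to [denq q] modulo p, hence
    coprime to p. *)
Lemma p_integral_unit1B (p : nat) (x : rat) :
  (1 < p)%N -> x / p%:R \in p_integral p ->
  1 - x != 0 /\ (1 - x)^-1 \in p_integral p.
Proof.
move=> p1 qi; have [q {}qi ->] : exists2 q, q \in p_integral p & x = p%:R * q.
  exists (x / p%:R) => //; rewrite mulrC divfK // pnatr_eq0; lia.
set c : int := denq q - p%:Z * numq q.
have cE : c%:~R = (1 - p%:R * q) * (denq q)%:~R :> rat.
  by rewrite /c intrD intrN intrM -pmulrn numqE; ring.
have cp : coprime p `|c|.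
  rewrite -[coprime _ _]/(coprimez p%:Z c).
  have : coprimez p%:Z (denq q) := qi.
  by rewrite /coprimez /c -mulrN [_ * - _]mulrC addrC gcdzMDl.
have d0 : (denq q)%:~R != 0 :> rat by rewrite intr_eq0 denq_neq0.
split.
  apply/eqP => x1; move: cE cp; rewrite x1 mul0r => /eqP.
  by rewrite intr_eq0 => /eqP ->; rewrite /coprime gcdn0; lia.
have -> : (1 - p%:R * q)^-1 = (denq q)%:~R * c%:~R^-1.
  by rewrite cE invfM [RHS]mulrCA mulfV // mulr1.
by rewrite rpredM ?rpred_int // p_integral_invr_int.
Qed.

(** * Rising factorials *)

Lemma pochS (a : rat) k : poch a k.+1 = poch a k * (a + k%:R).
Proof. by rewrite /poch big_ord_recr. Qed.

Lemma pochD (a : rat) m n : poch a (m + n) = poch a m * poch (a + m%:R) n.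
Proof.
by rewrite /poch big_split_ord /=; congr (_ * _); apply: eq_bigr => i _;
  rewrite natrD addrA.
Qed.

Lemma poch_neq0 (a : rat) k :
  (forall j : nat, a + j%:R != 0) -> poch a k != 0.
Proof. by move=> h; apply/prodf_neq0 => i _. Qed.

Lemma poch1 k : poch 1 k = k`!%:R.
Proof.
elim: k => [|k IH]; first by rewrite /poch big_ord0.
by rewrite pochS IH factS mulnC natrM -natr1 addrC.
Qed.

Lemma poch_opp (n : nat) k : (k <= n)%N ->
  poch (- n%:R) k * (n - k)`!%:R = (-1) ^+ k * n`!%:R.
Proof.
elim: k => [|k IH] kn; first by rewrite /poch big_ord0 subn0 expr0.
have := IH (ltnW kn); rewrite -(subnSK kn) factS pochS exprS natrM => e.
by rewrite -[RHS]mulrA -e subnSK // natrB ?(ltnW kn) //; ring.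
Qed.

(* Shifting the argument of the rising factorial by an integer turns the
   quotient of two rising factorials of varying length into a polynomial. *)
Lemma poch_shift (z : rat) (m k : nat) : (forall j : nat, z + j%:R != 0) ->
  poch (z + m%:R) k / poch z k = poch (z + k%:R) m / poch z m.
Proof.
move=> h; apply/eqP; rewrite eqr_div ?poch_neq0 //.
by rewrite mulrC -pochD addnC pochD mulrC.
Qed.

(** The second factorial is read backwards, so the two factors of each pair have a sum independent
    of i. Below, such pairs become k(k + A) plus a constant. *)
Lemma poch_rev (z A : rat) (m : nat) :
  \prod_(i < m) ((z + i%:R) * (A + m%:R - 1 - i%:R)) = poch z m * poch A m.
Proof.
rewrite big_split /=; congr (_ * _); rewrite /poch [RHS](reindex_inj rev_ord_inj).
by apply: eq_bigr => i _ /=; rewrite natrB // -natr1; ring.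
Qed.

(** * Divided differences and exact vanishing of the deformed sum *)

(** The sum is the coefficient of X^n in the Lagrange interpolation of [Q] at n + 1 nodes.
    Interpolation reproduces [Q], whose degree is less than n. *)
Lemma divided_difference_eq0 (F : fieldType) (n : nat) (x : nat -> F)
    (Q : {poly F}) : injective x -> (size Q <= n)%N ->
  \sum_(i < n.+1) Q.[x i] / \prod_(j < n.+1 | j != i) (x i - x j) = 0.
Proof.
move=> xinj sQ.
have := congr1 (coefp n) (lagrange_gen (ltn0Sn n) xinj (leqW sQ)).
rewrite /= (nth_default _ sQ) coef_sum => {2}->; apply: eq_bigr => i _.
rewrite coefCM lagrangeE //= coefCM; congr (_ * _).
set L := \prod_(j < n.+1 | j != i) ('X - (x j)%:P).
have -> : L`_n = 1.
  have sL : size L = n.+1.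
    rewrite /L size_prod /=; last by move=> j _; rewrite polyXsubC_eq0.
    rewrite (eq_bigr (fun=> (2 * 1)%N)); last by move=> j _; rewrite size_XsubC.
    by rewrite -big_distrr /= sum1_card cardC1 card_ord /= mul2n -addnn -addSn addnK.
  have -> : L`_n = lead_coef L by rewrite lead_coefE sL.
  by apply/monicP; apply: monic_prod => j _; apply: monicXsubC.
rewrite mulr1 horner_prod; congr (_ ^-1); apply: eq_bigr => j _.
by rewrite hornerXsubC.
Qed.

(* In a series well-poised in A, A + u is paired with
   1 + A - (A + u). In particular wp A 0 k = (A)_k / k!. *)
Definition wp (A u : rat) (k : nat) : rat := poch (A + u) k / poch (1 - u) k.

Definition regular (u : rat) : Prop := forall j : nat, 1 - u + j%:R != 0.

(** As y + y' = m + 1 - A, each numerator parameter is the other denominator parameter shifted by m: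
    A + y = 1 - y' + m. Crossing the two quotients and applying [poch_shift] leaves a polynomial in
    k(k + A) of degree m. *)
Lemma wp_pair (A y : rat) (m k : nat) :
  regular y -> regular (m%:R + 1 - A - y) ->
  wp A y k * wp A (m%:R + 1 - A - y) k =
    (poch (1 - y) m * poch (1 - (m%:R + 1 - A - y)) m)^-1 *
    \prod_(i < m) (k%:R * (k%:R + A) + (1 - y + i%:R) * (A - (1 - y + i%:R))).
Proof.
set y' := m%:R + 1 - A - y => ry ry'; rewrite /wp.
have -> : A + y = 1 - y' + m%:R by rewrite /y'; ring.
have -> : A + y' = 1 - y + m%:R by rewrite /y'; ring.
have e1 := poch_shift (1 - y) m k ry.
have e2 := poch_shift (1 - y') m k ry'.
have eP : \prod_(i < m) (k%:R * (k%:R + A) + (1 - y + i%:R) * (A - (1 - y + i%:R)))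
   = poch (1 - y + k%:R) m * poch (1 - y' + k%:R) m.
  by rewrite -poch_rev; apply: eq_bigr => i _; rewrite /y'; ring.
by rewrite mulrC mulf_div [poch (1 - y') k * _]mulrC -mulf_div e1 e2 eP mulf_div mulrC.
Qed.

(** The self-paired case y = y' = u: here A + u = 1 - u + 2h, and pairing the two halves of (1 - u +
    k)_(2h) gives degree only h in k(k + A). *)
Lemma wp_mid (A u : rat) (h k : nat) :
  regular u -> 2 * u = (2 * h)%:R + 1 - A ->
  wp A u k = (poch (1 - u) (h + h))^-1 *
    \prod_(i < h) (k%:R * (k%:R + A) + (1 - u + i%:R) * (A - (1 - u + i%:R))).
Proof.
move=> ru e; rewrite /wp.
have -> : A = (h + h)%:R + 1 - 2 * u by rewrite e addnn -mul2n; ring.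
have -> : (h + h)%:R + 1 - 2 * u + u = 1 - u + (h + h)%:R by ring.
have -> := poch_shift (1 - u) (h + h) k ru.
rewrite [LHS]mulrC [poch (_ + _) _]pochD; congr (_ * _); rewrite -poch_rev.
by apply: eq_bigr => i _; rewrite natrD; ring.
Qed.

Lemma prod_subn (n k : nat) : (k <= n)%N ->
  (\prod_(j < n.+1 | j != k :> nat) (k%:R - j%:R)) * poch (- n%:R) k =
  (-1) ^+ n * n`!%:R * k`!%:R :> rat.
Proof.
move=> kn; have nf0 : ((n - k)`!%:R : rat) != 0 by rewrite pnatr_eq0 -lt0n fact_gt0.
apply: (mulIf nf0); rewrite -[LHS]mulrA poch_opp //.
suff -> : \prod_(j < n.+1 | j != k :> nat) (k%:R - j%:R) =
    (-1) ^+ (n - k) * (n - k)`!%:R * k`!%:R :> rat.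
  have -> : (-1) ^+ n = (-1) ^+ (n - k) * (-1) ^+ k :> rat by rewrite -exprD subnK.
  by ring.
(* Induction on d = n - k with k fixed: the base case gives k!, and each new factor is negative. *)
suff prodE d : \prod_(j < (d + k).+1 | j != k :> nat) (k%:R - j%:R) =
    (-1) ^+ d * d`!%:R * k`!%:R :> rat by have := prodE (n - k)%N; rewrite subnK.
elim: d => [|d IH].
  rewrite add0n expr0 !mul1r big_mkcond big_ord_recr /= eqxx mulr1 -poch1.
  rewrite /poch [RHS](reindex_inj rev_ord_inj); apply: eq_bigr => i _ /=.
  by rewrite ltn_eqF //= natrB // -natr1; ring.
rewrite addSn big_mkcond big_ord_recr /= -big_mkcond IH ifT; last by lia.
by rewrite exprS factS natrM -addSn natrD; ring.
Qed.

(** With z_k = k(k + A), the difference z_k - z_j splits as (k - j)(A + k + j). The first factors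
    produce (-n)_k / k!, the second ones (A)_k / (A + n + 1)_k. *)
Lemma wp_ends (A : rat) (n k : nat) :
  (forall j : nat, A + j%:R != 0) -> (k <= n)%N ->
  (A + (2 * k)%:R) * wp A 0 k * wp A (- A - n%:R) k =
  (-1) ^+ n * n`!%:R * poch A n.+1 /
  \prod_(j < n.+1 | j != k :> nat)
     (k%:R * (k%:R + A) - j%:R * (j%:R + A)).
Proof.
move=> A0 kn.
rewrite (eq_bigr (fun j : 'I_n.+1 => (k%:R - j%:R) * (A + k%:R + j%:R)));
  last by move=> j _; ring.
rewrite big_split /=.
set P := \prod_(j < _ | _) (_ - _); set M := \prod_(j < _ | _) (_ + _).
(* The prefactor A + 2k is exactly the factor j = k left out of [M]. *)
have eM : (A + (2 * k)%:R) * M = poch (A + k%:R) n.+1.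
  rewrite /M /poch [RHS](bigD1 (Ordinal (kn : k < n.+1)%N)) //=; congr (_ * _).
  by rewrite natrM; ring.
have k0 : A + (2 * k)%:R != 0 := A0 _.
have M0 : M != 0 by apply/prodf_neq0 => j _; rewrite -addrA -natrD.
have P0 : P != 0.
  apply/prodf_neq0 => j jk.
  by rewrite subr_eq0 eqr_nat eq_sym.
have kf0 : (k`!%:R : rat) != 0 by rewrite pnatr_eq0 -lt0n fact_gt0.
have eP : P * poch (- n%:R) k = (-1) ^+ n * n`!%:R * k`!%:R by apply: prod_subn.
rewrite /wp addr0 subr0 poch1.
have -> : A + (- A - n%:R) = - n%:R by ring.
have -> : 1 - (- A - n%:R) = A + n.+1%:R by rewrite -natr1; ring.
have q0 : poch (A + n.+1%:R) k != 0.
  by apply: poch_neq0 => j; rewrite -addrA -natrD.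
have := pochD A n.+1 k; rewrite addnC pochD -eM => e.
have -> : (-1) ^+ n * n`!%:R = P * poch (- n%:R) k / k`!%:R.
  by rewrite eP mulfK.
have -> : poch A n.+1 =
    poch A k * ((A + (2 * k)%:R) * M) / poch (A + n.+1%:R) k by rewrite e mulfK.
move: (A + (2 * k)%:R) (poch A k) (poch (- n%:R) k) (k`!%:R) M P
  (poch (A + n.+1%:R) k) kf0 M0 P0 q0 {e eP eM k0} => *; field.
by apply/and4P; split.
Qed.

(** The parameters 0 and -A - n supply the node differences, by [wp_ends]; the other three supply
    the polynomial in z_k, by [wp_mid] and [wp_pair]. *)
Lemma wp_sum_eq0 (A y u : rat) (n h : nat) :
  (forall j : nat, A + j%:R != 0) ->
  regular y -> regular ((2 * h)%:R + 1 - A - y) -> regular u ->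
  2 * u = (2 * h)%:R + 1 - A -> (3 * h < n)%N ->
  \sum_(k < n.+1) (A + (2 * k)%:R) * (wp A 0 k * wp A (- A - n%:R) k *
    wp A u k * wp A y k * wp A ((2 * h)%:R + 1 - A - y) k) = 0.
Proof.
move=> A0 ry ry' ru e hn.
pose z (k : nat) : rat := k%:R * (k%:R + A).
have z_inj : injective z.
  move=> i j /eqP; rewrite /z -subr_eq0.
  have -> : i%:R * (i%:R + A) - j%:R * (j%:R + A) =
      (i%:R - j%:R) * (A + (i + j)%:R) by rewrite natrD; ring.
  by rewrite mulf_eq0 (negbTE (A0 _)) orbF subr_eq0 eqr_nat => /eqP.
pose lin (v : rat) m : {poly rat} :=
  \prod_(i < m) ('X + ((1 - v + i%:R) * (A - (1 - v + i%:R)))%:P).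
have lin_size v m : size (lin v m) = m.+1.
  rewrite size_prod; last by move=> i _; rewrite -size_poly_eq0 size_XaddC.
  rewrite (eq_bigr (fun=> (2 * 1)%N)); last by move=> j _; rewrite size_XaddC.
  by rewrite -big_distrr /= sum1_card !card_ord; lia.
have linE v m k : (lin v m).[z k] = \prod_(i < m)
    (k%:R * (k%:R + A) + (1 - v + i%:R) * (A - (1 - v + i%:R))).
  by rewrite horner_prod; apply: eq_bigr => i _; rewrite hornerD hornerX hornerC.
(* The degree is 2h from the pair plus h from the middle parameter, that is 3h < n. *)
have sQ : (size (lin y (2 * h)%N * lin u h)%R <= n)%N.
  by apply: (leq_trans (size_mul_leq _ _)); rewrite !lin_size; lia.
have := divided_difference_eq0 _ _ _ _ z_inj sQ.
move/(congr1 ( *%R ((-1) ^+ n * n`!%:R * poch A n.+1 *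
  (poch (1 - u) (h + h))^-1 *
  (poch (1 - y) (2 * h) * poch (1 - ((2 * h)%:R + 1 - A - y)) (2 * h))^-1))).
rewrite mulr0 big_distrr => E; rewrite -[RHS]E /=; apply: eq_bigr => k _.
have k_le : (k <= n)%N by rewrite -ltnS.
have := wp_ends A n k A0 k_le; have := wp_mid A u h k ru e.
have := wp_pair A y (2 * h) k ry ry'.
rewrite hornerM !linE.
move=> e1 e2 e3.
set a := A + _; set w0 := wp A 0 k; set we := wp A (- A - _) k.
have -> : forall w1 w2 w3, a * (w0 * we * w1 * w2 * w3) =
    (a * w0 * we) * w1 * (w2 * w3) by move=> *; ring.
rewrite e1 e2 e3.

ring.
Qed.

(** * Expansion of the deformed summand modulo p^4 *)

Ltac p_int :=
  try eassumption;
  lazymatch goal with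
  | |- is_true (_ + _ \in _) => apply: rpredD; p_int
  | |- is_true (- _ \in _) => rewrite rpredN; p_int
  | |- is_true (_ * _ \in _) => apply: rpredM; p_int
  | |- is_true (_ ^+ _ \in _) => apply: rpredX; p_int
  | |- is_true (1 \in _) => exact: rpred1
  | |- is_true (_%:R \in _) => exact: rpred_nat
  | |- _ => idtac
  end.

Lemma wpS (A u : rat) k :
  wp A u k.+1 = wp A u k * ((A + u + k%:R) / (1 - u + k%:R)).
Proof. by rewrite /wp !pochS mulf_div. Qed.

Lemma wp0 (A u : rat) : wp A u 0 = 1.
Proof. by rewrite /wp /poch !big_ord0 divr1. Qed.

Lemma wp_opp (n k : nat) : (k <= n)%N ->
  wp (- n%:R) 0 k = (-1) ^+ k * (n`!%:R / (k`!%:R * (n - k)`!%:R)).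
Proof.
move=> kn; have := poch_opp _ _ kn; rewrite /wp addr0 subr0 poch1 => e.
have f0 i : (i`!%:R : rat) != 0 by rewrite pnatr_eq0 -lt0n fact_gt0.
by rewrite mulrA -e; field; rewrite !f0.
Qed.

(* Second and third elementary symmetric functions of v1, v2, v3 and
   -(v1 + v2 + v3). *)
Definition sym2 (v1 v2 v3 : rat) : rat :=
  v1 * v2 + v1 * v3 + v2 * v3 - (v1 + v2 + v3) ^+ 2.
Definition sym3 (v1 v2 v3 : rat) : rat :=
  v1 * v2 * v3 - (v1 + v2 + v3) * (v1 * v2 + v1 * v3 + v2 * v3).

(** Coefficients of e2 and e3 in the deformed summand, divided by the undeformed one. The signs
    differ because u enters the denominators as -u, giving a^m - (-b)^m. *)
Definition harm2 (A : rat) (k : nat) : rat :=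
  \sum_(j < k) ((A + j%:R)^-1 ^+ 2 - (1 + j%:R)^-1 ^+ 2).
Definition harm3 (A : rat) (k : nat) : rat :=
  \sum_(j < k) ((A + j%:R)^-1 ^+ 3 + (1 + j%:R)^-1 ^+ 3).

(** Since e1 = 0, the numerator is P(a) and the denominator P(-b), with P(t) = 1 + p^2 e2 t^2 + p^3
    e3 t^3 + p^4 e4 t^4. *)
Lemma factor_expand (p : nat) (v1 v2 v3 a b : rat) : (1 < p)%N ->
  v1 \in p_integral p -> v2 \in p_integral p -> v3 \in p_integral p ->
  a \in p_integral p -> b \in p_integral p ->
  let v4 := - (v1 + v2 + v3) in
  exists2 q, q \in p_integral p &
  (1 + p%:R * v1 * a) / (1 - p%:R * v1 * b) *
  ((1 + p%:R * v2 * a) / (1 - p%:R * v2 * b)) *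
  ((1 + p%:R * v3 * a) / (1 - p%:R * v3 * b)) *
  ((1 + p%:R * v4 * a) / (1 - p%:R * v4 * b)) =
  1 + p%:R ^+ 2 * sym2 v1 v2 v3 * (a ^+ 2 - b ^+ 2)
    + p%:R ^+ 3 * sym3 v1 v2 v3 * (a ^+ 3 + b ^+ 3) + p%:R ^+ 4 * q.
Proof.
move=> p1 v1i v2i v3i ai bi v4.
have p_neq0 : (p%:R : rat) != 0 by rewrite pnatr_eq0; lia.
have v4i : v4 \in p_integral p by rewrite /v4; p_int.
have unit v : v \in p_integral p ->
    1 - p%:R * v * b != 0 /\ (1 - p%:R * v * b)^-1 \in p_integral p.
  by move=> vi; apply: p_integral_unit1B => //; rewrite mulrC -mulrA mulKf // rpredM.
have [n1 i1] := unit _ v1i; have [n2 i2] := unit _ v2i.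
have [n3 i3] := unit _ v3i; have [n4 i4] := unit _ v4i.
set e2 := sym2 v1 v2 v3; set e3 := sym3 v1 v2 v3; set e4 := v1 * v2 * v3 * v4.
have e2i : e2 \in p_integral p by rewrite /e2 /sym2; p_int.
have e3i : e3 \in p_integral p by rewrite /e3 /sym3; p_int.
have e4i : e4 \in p_integral p by rewrite /e4; p_int.
pose g := e2 * (a ^+ 2 - b ^+ 2) + p%:R * e3 * (a ^+ 3 + b ^+ 3).
have gi : g \in p_integral p by rewrite /g; p_int.
(* This is (P(a) - P(-b)(1 + p^2 g)) / (p^4 P(-b)); the terms of lower order cancel. *)
exists ((e4 * a ^+ 4 - e4 * b ^+ 4 * (1 + p%:R ^+ 2 * g) - e2 * b ^+ 2 * g
   + p%:R * e3 * b ^+ 3 * g) * (1 - p%:R * v1 * b)^-1 * (1 - p%:R * v2 * b)^-1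
   * (1 - p%:R * v3 * b)^-1 * (1 - p%:R * v4 * b)^-1).
  by p_int.
rewrite /g /e4 /e3 /e2 /sym2 /sym3 /v4; field.
by apply/and4P; split.
Qed.

Lemma wp_expand (p : nat) (v1 v2 v3 A : rat) (k : nat) : (1 < p)%N ->
  v1 \in p_integral p -> v2 \in p_integral p -> v3 \in p_integral p ->
  (forall j : nat, (j < k)%N -> A + j%:R != 0 /\
     (A + j%:R)^-1 \in p_integral p /\ (1 + j%:R)^-1 \in p_integral p) ->
  exists2 q, q \in p_integral p &
  wp A 0 k * wp A (p%:R * v1) k * wp A (p%:R * v2) k * wp A (p%:R * v3) k *
    wp A (p%:R * - (v1 + v2 + v3)) k =
  wp A 0 k ^+ 5 * (1 + p%:R ^+ 2 * sym2 v1 v2 v3 * harm2 A k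
    + p%:R ^+ 3 * sym3 v1 v2 v3 * harm3 A k + p%:R ^+ 4 * q).
Proof.
move=> p1 v1i v2i v3i; elim: k => [|k IH] units.
  exists 0; first exact: rpred0.
  by rewrite !wp0 /harm2 /harm3 !big_ord0; ring.
have {IH} [|q qi IH] := IH; first by move=> j jk; apply: units; rewrite ltnW.
have [a0 [ai bi]] := units k (ltnSn k).
have b0 : (1 + k%:R : rat) != 0 by rewrite nat1r pnatr_eq0.
have [q' q'i e] := factor_expand p v1 v2 v3 _ _ p1 v1i v2i v3i ai bi.
have H2i : harm2 A k \in p_integral p.
  apply: rpred_sum => j _; have [_ [? ?]] := units j (leqW (ltn_ord j)); p_int.
have H3i : harm3 A k \in p_integral p.
  apply: rpred_sum => j _; have [_ [? ?]] := units j (leqW (ltn_ord j)); p_int.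
set a := A + k%:R in a0 ai e *; set b : rat := 1 + k%:R in b0 bi e *.
set s2 := sym2 v1 v2 v3 in IH e *; set s3 := sym3 v1 v2 v3 in IH e *.
have s2i : s2 \in p_integral p by rewrite /s2 /sym2; p_int.
have s3i : s3 \in p_integral p by rewrite /s3 /sym3; p_int.
pose h2 := a^-1 ^+ 2 - b^-1 ^+ 2; pose h3 := a^-1 ^+ 3 + b^-1 ^+ 3.
(* The terms of order at least p^4 in the product of the expansion up to k with that of the k-th
   factor. *)
exists (s2 ^+ 2 * harm2 A k * h2 + p%:R * s2 * s3 * (harm2 A k * h3 + harm3 A k * h2)
  + p%:R ^+ 2 * s3 ^+ 2 * harm3 A k * h3
  + q * (1 + p%:R ^+ 2 * s2 * h2 + p%:R ^+ 3 * s3 * h3 + p%:R ^+ 4 * q')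
  + q' * (1 + p%:R ^+ 2 * s2 * harm2 A k + p%:R ^+ 3 * s3 * harm3 A k)).
  by rewrite /h2 /h3; p_int.
have -> : harm2 A k.+1 = harm2 A k + h2 by rewrite /harm2 big_ord_recr.
have -> : harm3 A k.+1 = harm3 A k + h3 by rewrite /harm3 big_ord_recr.
pose f v := (1 + p%:R * v * a^-1) / (1 - p%:R * v * b^-1).
have {}e : f v1 * f v2 * f v3 * f (- (v1 + v2 + v3)) =
    1 + p%:R ^+ 2 * s2 * h2 + p%:R ^+ 3 * s3 * h3 + p%:R ^+ 4 * q' := e.
have step v : wp A (p%:R * v) k.+1 = wp A (p%:R * v) k * (a / b * f v).
  rewrite wpS; congr (_ * _).
  have -> : A + p%:R * v + k%:R = a * (1 + p%:R * v * a^-1).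
    by rewrite /a in a0 *; field.
  have -> : 1 - p%:R * v + k%:R = b * (1 - p%:R * v * b^-1).
    by rewrite /b in b0 *; field.
  by rewrite mulf_div.
have -> : wp A 0 k.+1 = wp A 0 k * (a / b).
  by rewrite wpS addr0 subr0.
rewrite !step; transitivity
  ((wp A 0 k * wp A (p%:R * v1) k * wp A (p%:R * v2) k * wp A (p%:R * v3) k *
    wp A (p%:R * - (v1 + v2 + v3)) k) *
   (f v1 * f v2 * f v3 * f (- (v1 + v2 + v3))) * (a / b) ^+ 5); first by ring.
by rewrite IH e; ring.
Qed.

(** * Antisymmetry of the cubic term at A = -n *)

(** At A = -n the factor is a binomial coefficient with sign (-1)^k, and n - k has the parity of
    k. *)
Lemma wp_opp_sym (n k : nat) : ~~ odd n -> (k <= n)%N ->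
  wp (- n%:R) 0 (n - k) = wp (- n%:R) 0 k.
Proof.
move=> n_even kn; rewrite !wp_opp ?leq_subr // subKn // [(_ - k)`!%:R * _]mulrC.
by rewrite -signr_odd oddB // (negbTE n_even) signr_odd.
Qed.

(** The numbers n - j for j < k are the last k of 1, ..., n, so their sum of inverse cubes is a full
    sum minus an initial one. The result is visibly symmetric under k |-> n - k. *)
Lemma harm3_opp (n k : nat) : (k <= n)%N ->
  harm3 (- n%:R) k =
  \sum_(j < k) (1 + j%:R)^-1 ^+ 3 + \sum_(j < n - k) (1 + j%:R)^-1 ^+ 3
  - \sum_(j < n) (1 + j%:R)^-1 ^+ 3.
Proof.
move=> kn; rewrite /harm3 big_split /= addrC -addrA; congr (_ + _).
suff -> : \sum_(j < n) (1 + j%:R)^-1 ^+ 3 = \sum_(j < n - k) (1 + j%:R)^-1 ^+ 3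
    - \sum_(j < k) (- n%:R + j%:R)^-1 ^+ 3 :> rat by ring.
have -> : \sum_(j < n) (1 + j%:R)^-1 ^+ 3 =
    \sum_(j < n - k + k) (1 + j%:R)^-1 ^+ 3 :> rat by rewrite subnK.
rewrite big_split_ord /=; congr (_ + _).
rewrite -sumrN [RHS](reindex_inj rev_ord_inj); apply: eq_bigr => j _ /=.
have -> : - n%:R + (k - j.+1)%:R = - (1 + (n - k + j)%:R) :> rat.
  by rewrite natrD !natrB // -natr1; ring.
by rewrite invrN; ring.
Qed.

Lemma wp_harm3_opp_sum (n : nat) : ~~ odd n ->
  \sum_(k < n.+1) (- n%:R + (2 * k)%:R) * (wp (- n%:R) 0 k ^+ 5 * harm3 (- n%:R) k)
  = 0.
Proof.
move=> n_even; set S := LHS; suff : S = - S by lra.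
rewrite /S {1}(reindex_inj rev_ord_inj) -sumrN; apply: eq_bigr => k _ /=.
have k_le : (k <= n)%N by rewrite -ltnS.
rewrite subSS wp_opp_sym // !harm3_opp ?leq_subr // subKn //.
by rewrite !natrM natrB //; ring.
Qed.

(** * Transfer from A to -n modulo p, and the tail *)

Definition cong (p : nat) (x y : rat) : Prop := (x - y) / p%:R \in p_integral p.

Lemma congD (p : nat) (x x' y y' : rat) :
  cong p x x' -> cong p y y' -> cong p (x + y) (x' + y').
Proof. by move=> cx cy; rewrite /cong opprD addrACA mulrDl rpredD. Qed.

Lemma congM (p : nat) (x x' y y' : rat) :
  x \in p_integral p -> y' \in p_integral p ->
  cong p x x' -> cong p y y' -> cong p (x * y) (x' * y').
Proof.
move=> xi yi cx cy; rewrite /cong.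
have -> : (x * y - x' * y') / p%:R = x * ((y - y') / p%:R) + (x - x') / p%:R * y'.
  by ring.
by p_int.
Qed.

Lemma cong_refl (p : nat) (x : rat) : cong p x x.
Proof. by rewrite /cong subrr mul0r rpred0. Qed.

Lemma congX (p : nat) (x x' : rat) (m : nat) :
  x \in p_integral p -> x' \in p_integral p ->
  cong p x x' -> cong p (x ^+ m) (x' ^+ m).
Proof.
move=> xi yi c; elim: m => [|m IH]; first exact: cong_refl.
by rewrite !exprS; apply: congM => //; p_int.
Qed.

Lemma cong_sum (p n : nat) (f g : 'I_n -> rat) :
  (forall k, cong p (f k) (g k)) ->
  cong p (\sum_(k < n) f k) (\sum_(k < n) g k).
Proof.
move=> c; elim/big_ind2: _; [exact: cong_refl| |by move=> i _; apply: c].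
by move=> *; apply: congD.
Qed.

Lemma congV (p : nat) (x y : rat) : x != 0 -> y != 0 ->
  x^-1 \in p_integral p -> y^-1 \in p_integral p ->
  cong p x y -> cong p x^-1 y^-1.
Proof.
move=> x0 y0 xi yi c; rewrite /cong.
have -> : (x^-1 - y^-1) / p%:R = - ((x - y) / p%:R) * x^-1 * y^-1.
  have [-> |p0] := eqVneq (p%:R : rat) 0; first by rewrite invr0; ring.
  by field; rewrite p0 x0 y0.
by p_int.
Qed.

Lemma wp_integral (p : nat) (A : rat) (k : nat) : A \in p_integral p ->
  (forall j : nat, (j < k)%N -> (1 + j%:R)^-1 \in p_integral p) ->
  wp A 0 k \in p_integral p.
Proof.
move=> Ai; elim: k => [|k IH] units; first by rewrite wp0 rpred1.
rewrite wpS addr0 subr0; have ui := units k (ltnSn k).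
by have wi := IH (fun j jk => units j (leqW jk)); p_int.
Qed.

Lemma harm3_integral (p : nat) (A : rat) (k : nat) :
  (forall j : nat, (j < k)%N -> (A + j%:R)^-1 \in p_integral p) ->
  (forall j : nat, (j < k)%N -> (1 + j%:R)^-1 \in p_integral p) ->
  harm3 A k \in p_integral p.
Proof.
move=> a b; apply: rpred_sum => j _.
by have aj := a j (ltn_ord j); have bj := b j (ltn_ord j); p_int.
Qed.

(** Only A + j and 1 + j with j < n are inverted, all units at p, so the summand depends on A modulo
    p only, and A may be replaced by -n, where the sum is zero. *)
Lemma wp_harm3_sum (p n : nat) (A : rat) : ~~ odd n ->
  A \in p_integral p -> cong p A (- n%:R) ->
  (forall j : nat, (j < n)%N -> A + j%:R != 0 /\ (A + j%:R)^-1 \in p_integral p) ->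
  (forall j : nat, (j < n)%N -> (1 + j%:R)^-1 \in p_integral p) ->
  (\sum_(k < n.+1) (A + (2 * k)%:R) * (wp A 0 k ^+ 5 * harm3 A k)) / p%:R
    \in p_integral p.
Proof.
move=> n_even Ai cA a b.
have ni : - n%:R \in p_integral p by p_int.
have b' j : (j < n)%N -> (- n%:R + j%:R)^-1 \in p_integral p.
  move=> jn; have -> : - n%:R + j%:R = - (1 + (n - j.+1)%:R) :> rat.
    by rewrite natrB // -natr1; ring.
  by rewrite invrN rpredN; apply: b; lia.
set S := \sum_(k < _) _.
suff : cong p S (\sum_(k < n.+1) (- n%:R + (2 * k)%:R) *
    (wp (- n%:R) 0 k ^+ 5 * harm3 (- n%:R) k)).
  by rewrite wp_harm3_opp_sum // /cong subr0.
apply: cong_sum => -[k kn] /=.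
have cA' j : cong p (A + j%:R) (- n%:R + j%:R) by apply: congD => //; apply: cong_refl.
have {}a j : (j < k)%N -> A + j%:R != 0 /\ (A + j%:R)^-1 \in p_integral p.
  by move=> jk; apply: a; lia.
have {}b j : (j < k)%N -> (1 + j%:R)^-1 \in p_integral p.
  by move=> jk; apply: b; lia.
have {}b' j : (j < k)%N -> (- n%:R + j%:R)^-1 \in p_integral p.
  by move=> jk; apply: b'; lia.
have cw : cong p (wp A 0 k) (wp (- n%:R) 0 k).
  elim: k a b b' {kn} => [|k IH] a b b'; first by rewrite !wp0; apply: cong_refl.
  have bk := b k (ltnSn k).
  rewrite !wpS !(addr0, subr0); apply: congM.
  - by apply: wp_integral => // j jk; apply: b; apply: leqW.
  - by p_int.
  - by apply: IH => j jk; [apply: a|apply: b|apply: b']; apply: leqW.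
  - by apply: congM => //; [p_int | exact: cong_refl].
have ch : cong p (harm3 A k) (harm3 (- n%:R) k).
  apply: cong_sum => -[j jk] /=; apply: congD; last exact: cong_refl.
  have [aj0 aji] := a j jk; apply: congX => //; [exact: b'|].
  apply: congV => //; [|exact: b'].
  have -> : - n%:R + j%:R = - (n - j)%:R :> rat by rewrite natrB; [ring|lia].
  by rewrite oppr_eq0 pnatr_eq0; lia.
apply: congM => //; first by p_int.
  have wi := wp_integral p (- n%:R) k ni b.
  have hi := harm3_integral p (- n%:R) k b' b.
  by p_int.
apply: congM => //.
- by apply: rpredX; apply: wp_integral.
- exact: harm3_integral.
- by apply: congX => //; apply: wp_integral.
Qed.

(** Once k > n, the numerator (A)_k contains the factor A + n = p c, while the denominators stay
    units. *)
Lemma wp_tail_integral (p n k : nat) (A c : rat) :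
  A \in p_integral p -> c \in p_integral p -> A + n%:R = p%:R * c ->
  (0 < p)%N -> (n < k)%N ->
  (forall j : nat, (j < k)%N -> (1 + j%:R)^-1 \in p_integral p) ->
  wp A 0 k / p%:R \in p_integral p.
Proof.
move=> Ai ci An p_gt0; elim: k => [//|k IH] nk units.
have uk := units k (ltnSn k).
have units' j : (j < k)%N -> (1 + j%:R)^-1 \in p_integral p.
  by move=> jk; apply: units; apply: leqW.
rewrite wpS addr0 subr0; move: nk; rewrite ltnS leq_eqVlt => /orP[/eqP nk|nk].
  have wi := wp_integral p A k Ai units'.
  have -> : wp A 0 k * ((A + k%:R) / (1 + k%:R)) / p%:R =
      wp A 0 k * c * (1 + k%:R)^-1.
    rewrite -nk An; field; rewrite nat1r !pnatr_eq0; lia.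
  by p_int.
have wi := IH nk units'; rewrite mulrAC; p_int.
Qed.

(** * The supercongruence for A = 3p/5 - n *)

Section Supercongruence.
Variables (p n h : nat) (A : rat).
Hypotheses (p_pr : prime p) (p_n5 : p != 5) (n_even : ~~ odd n).
Hypotheses (pE : p = (n + (2 * h).+1)%N) (hn : (3 * h < n)%N).
Hypotheses (AE : 5 * A + 5 * n%:R = 3 * p%:R) (A0 : forall j : nat, A + j%:R != 0).

Let p_gt0 := prime_gt0 p_pr.
Let p_gt1 := prime_gt1 p_pr.

(** The bound n + 2h is p - 1, so 0 < 1 + j < p. *)
Lemma natr_unit j : (j < n + 2 * h)%N -> (1 + j%:R)^-1 \in p_integral p.
Proof.
move=> jn; rewrite nat1r; apply: p_integral_invr_nat.
by rewrite prime_coprime // gtnNdvd //; lia.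
Qed.

Lemma fifth_integral : 5^-1 \in p_integral p.
Proof. by apply: p_integral_invr_nat; rewrite prime_coprime // dvdn_prime2. Qed.

Lemma A_integral : A \in p_integral p.
Proof.
have i5 := fifth_integral.
have -> : A = 3 * p%:R * 5^-1 - n%:R by rewrite -AE; field.
by p_int.
Qed.

(** A + j = -(n - j)(1 - x) with x divisible by p and 0 < n - j < p. *)
Lemma A_unit j : (j < n)%N -> (A + j%:R)^-1 \in p_integral p.
Proof.
move=> jn; have i5 := fifth_integral.
have i1 : (1 + (n - j.+1)%:R)^-1 \in p_integral p by apply: natr_unit; lia.
have e : 1 + (n - j.+1)%:R = n%:R - j%:R :> rat by rewrite natrB // -natr1; ring.
have nj : n%:R - j%:R != 0 :> rat by rewrite subr_eq0 eqr_nat; lia.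
pose x : rat := p%:R * (3 * 5^-1 * (n%:R - j%:R)^-1).
have [||x1 x1i] := p_integral_unit1B p x; first exact: p_gt1.
  rewrite /x mulrC mulKf ?pnatr_eq0 -?lt0n //; rewrite -e; p_int.
have -> : (A + j%:R)^-1 = - (1 - x)^-1 * (n%:R - j%:R)^-1.
  have -> : A + j%:R = - (1 - x) * (n%:R - j%:R).
    have -> : A = 3 * p%:R * 5^-1 - n%:R by rewrite -AE; field.
    by rewrite /x; field.
  by rewrite invfM invrN.
by rewrite -e; p_int.
Qed.

(** A zero would give 5(j + 1) = w p, but 5 divides neither p nor a nonzero w < 5; and w = 0 would
    force j + 1 = 0. *)
Lemma regular_fifth w : (w < 5)%N -> regular (p%:R * (w%:R / 5)).
Proof.
move=> w5 j; apply/eqP => e.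
have : (5 * j.+1)%:R = (w * p)%:R :> rat.
  rewrite !natrM -[j.+1%:R]nat1r; apply/eqP; rewrite -subr_eq0; apply/eqP.
  by transitivity (5 * (1 - p%:R * (w%:R / 5) + j%:R) : rat);
    [field | rewrite e mulr0].
move/eqP; rewrite eqr_nat => /eqP ewp.
have : (5 %| w * p)%N by rewrite -ewp dvdn_mulr.
rewrite Euclid_dvdM // [(5 %| p)%N]dvdn_prime2 // [_ == p]eq_sym (negbTE p_n5) orbF.
have [w0|w0] := posnP w; last by move/(dvdn_leq w0); lia.
by move: ewp; rewrite w0; lia.
Qed.

(** Here 2h + 1 - A = 2p/5: so p/5 is the middle parameter, xp/5 and (2 - x)p/5 form a pair, and
    -3p/5 = -A - n terminates the sum. *)
Lemma deformed_sum_eq0 x : (x < 2)%N ->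
  \sum_(k < n.+1) (A + (2 * k)%:R) * (wp A 0 k * wp A (p%:R * - (3 / 5)) k *
    wp A (p%:R * (1 / 5)) k * wp A (p%:R * (x%:R / 5)) k *
    wp A (p%:R * - (- (3 / 5) + 1 / 5 + x%:R / 5)) k) = 0.
Proof.
move=> x2; have r1 := regular_fifth 1 isT.
have rx : regular (p%:R * (x%:R / 5)) by apply: regular_fifth; lia.
have r2x : regular (p%:R * ((2 - x)%N%:R / 5)) by apply: regular_fifth; lia.
have pE' : p%:R = n%:R + (2 * h)%:R + 1 :> rat.
  by rewrite pE natrD -natr1 addrA.
have eA : A = 3 * p%:R / 5 - n%:R by rewrite -AE; field.
have e2x : p%:R * ((2 - x)%N%:R / 5) =
    (2 * h)%:R + 1 - A - p%:R * (x%:R / 5).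
  rewrite natrB 1?ltnW // eA; have -> : (2 * h)%:R + 1 = p%:R - n%:R :> rat.
    by rewrite pE'; ring.
  by field.
have e1 : 2 * (p%:R * (1 / 5)) = (2 * h)%:R + 1 - A.
  rewrite eA; have -> : (2 * h)%:R + 1 = p%:R - n%:R :> rat.
    by rewrite pE'; ring.
  by field.
have E := wp_sum_eq0 A (p%:R * (x%:R / 5)) (p%:R * (1 / 5)) n h A0 rx.
rewrite -e2x in E; rewrite -[RHS](E r2x r1 e1 hn).
apply: eq_bigr => k _; congr (_ * (_ * _ * _ * _ * _)); congr (wp A _ k).
  by rewrite eA; field.
by rewrite natrB 1?ltnW //; field.
Qed.

Lemma deformed_sum_expand x : (x < 2)%N ->
  (\sum_(k < n.+1) (A + (2 * k)%:R) * wp A 0 k ^+ 5 +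
   p%:R ^+ 2 * sym2 (- (3 / 5)) (1 / 5) (x%:R / 5) *
   \sum_(k < n.+1) (A + (2 * k)%:R) * (wp A 0 k ^+ 5 * harm2 A k))
   / p%:R ^+ 4 \in p_integral p.
Proof.
move=> x2; have i5 := fifth_integral; have iA := A_integral.
set S0 := \sum_(k < _) _; set S1 := \sum_(k < _) _.
pose S2 := \sum_(k < n.+1) (A + (2 * k)%:R) * (wp A 0 k ^+ 5 * harm3 A k).
set v1 : rat := - (3 / 5); set v2 : rat := 1 / 5; set v3 : rat := x%:R / 5.
have v1i : v1 \in p_integral p by rewrite /v1; p_int.
have v2i : v2 \in p_integral p by rewrite /v2; p_int.
have v3i : v3 \in p_integral p by rewrite /v3; p_int.
have S2i : S2 / p%:R \in p_integral p.
  apply: wp_harm3_sum => //.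
  - rewrite /cong opprK; have -> : A + n%:R = p%:R * (3 / 5).
      by apply: (mulfI (_ : 5 != 0)) => //; rewrite mulrDr AE; field.
    by rewrite mulrC mulKf ?pnatr_eq0 -?lt0n //; p_int.
  - by move=> j jn; split; [exact: A0|exact: A_unit].
  - by move=> j jn; apply: natr_unit; lia.
have s3i : sym3 v1 v2 v3 \in p_integral p by rewrite /sym3; p_int.
have p_neq0 : (p%:R : rat) != 0 by rewrite pnatr_eq0 -lt0n.
(* The cubic term can be added freely: p^3 e3 S2 is divisible by p^4. *)
suff di : (- (S0 + p%:R ^+ 2 * sym2 v1 v2 v3 * S1 + p%:R ^+ 3 * sym3 v1 v2 v3 * S2))
    / p%:R ^+ 4 \in p_integral p.
  have alg s2 s3 S S' S'' : (S + p%:R ^+ 2 * s2 * S') / p%:R ^+ 4 =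
    - (- (S + p%:R ^+ 2 * s2 * S' + p%:R ^+ 3 * s3 * S'') / p%:R ^+ 4)
    - s3 * (S'' / p%:R) :> rat by field.
  rewrite (alg _ (sym3 v1 v2 v3) _ _ S2).
  by apply: rpredB; [rewrite rpredN|apply: rpredM].
(* The 0 is replaced by the vanishing deformed sum, so that the difference can be bounded term by
   term. *)
rewrite -[X in X / _]add0r -[X in (X + _) / _](deformed_sum_eq0 x x2).
have -> : S0 + p%:R ^+ 2 * sym2 v1 v2 v3 * S1 + p%:R ^+ 3 * sym3 v1 v2 v3 * S2 =
    \sum_(k < n.+1) ((A + (2 * k)%:R) * wp A 0 k ^+ 5 +
      p%:R ^+ 2 * sym2 v1 v2 v3 * ((A + (2 * k)%:R) * (wp A 0 k ^+ 5 * harm2 A k)) +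
      p%:R ^+ 3 * sym3 v1 v2 v3 * ((A + (2 * k)%:R) * (wp A 0 k ^+ 5 * harm3 A k))).
  by rewrite 2!big_split /= -2!mulr_sumr.
rewrite -sumrB mulr_suml.
apply: rpred_sum => -[k kn] _ /=.
have [|q qi ->] := wp_expand p v1 v2 v3 A k p_gt1 v1i v2i v3i.
  move=> j jk; split; first exact: A0.
  by split; [apply: A_unit; lia|apply: natr_unit; lia].
have wi : wp A 0 k \in p_integral p.
  by apply: wp_integral => // j jk; apply: natr_unit; lia.
have -> : forall a w s2 s3 H2 H3 : rat,
  (a * (w ^+ 5 * (1 + p%:R ^+ 2 * s2 * H2 + p%:R ^+ 3 * s3 * H3 + p%:R ^+ 4 * q))
  - (a * w ^+ 5 + p%:R ^+ 2 * s2 * (a * (w ^+ 5 * H2)) +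
     p%:R ^+ 3 * s3 * (a * (w ^+ 5 * H3)))) / p%:R ^+ 4 = a * w ^+ 5 * q.
  by move=> *; field.
by p_int.
Qed.

Lemma truncated_sum_integral :
  (\sum_(k < n.+1) (A + (2 * k)%:R) * wp A 0 k ^+ 5) / p%:R ^+ 4 \in p_integral p.
Proof.
have := deformed_sum_expand 0 isT; have := deformed_sum_expand 1 isT.
set S0 := \sum_(k < _) _; set S1 := \sum_(k < _) _ => d1 d0.
(* The coefficient of S1 is proportional to 7(-6) - 6(-7) = 0. *)
have -> : S0 / p%:R ^+ 4 =
  7 * ((S0 + p%:R ^+ 2 * sym2 (- (3 / 5)) (1 / 5) (1%:R / 5) * S1) / p%:R ^+ 4) -
  6 * ((S0 + p%:R ^+ 2 * sym2 (- (3 / 5)) (1 / 5) (0%:R / 5) * S1) / p%:R ^+ 4).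
  by rewrite /sym2; field; rewrite pnatr_eq0 -lt0n.
by p_int.
Qed.

Lemma full_sum_integral :
  (\sum_(k < p) (A + (2 * k)%:R) * wp A 0 k ^+ 5) / p%:R ^+ 4 \in p_integral p.
Proof.
have iA := A_integral; have i5 := fifth_integral.
have -> : \sum_(k < p) (A + (2 * k)%:R) * wp A 0 k ^+ 5 =
    \sum_(k < n.+1 + 2 * h) (A + (2 * k)%:R) * wp A 0 k ^+ 5.
  by rewrite pE addnS.
rewrite big_split_ord mulrDl; apply: rpredD; first exact: truncated_sum_integral.
rewrite big_distrl; apply: rpred_sum => -[i ih] _ /=.
have wi : wp A 0 (n.+1 + i) / p%:R \in p_integral p.
  apply: (wp_tail_integral p n _ A (3 / 5)) => //; [|lia|].
    by apply: (mulfI (_ : 5 != 0)) => //; rewrite mulrDr AE; field.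
  by move=> j jk; apply: natr_unit; lia.
(* The fifth power contributes p^5, one more factor p than needed. *)
rewrite (_ : _ / _ = (A + (2 * (n.+1 + i))%:R) * p%:R *
   (wp A 0 (n.+1 + i) / p%:R) ^+ 5); first by p_int.
by field; rewrite pnatr_eq0 -lt0n.
Qed.
End Supercongruence.

(** * From r and p to the section parameters *)

Lemma rat_congr0 (p : nat) (x : rat) : prime p ->
  x / p%:R ^+ 4 \in p_integral p -> rat_congr p 4 x 0.
Proof.
move=> p_pr xi; exists (x / p%:R ^+ 4); split.
  by rewrite /padic_int -prime_coprime.
rewrite subr0 natrX mulrC divfK // expf_neq0 // pnatr_eq0 -lt0n prime_gt0 //.
Qed.

Theorem theorem1 (r : int) (p : nat) :
  r <= 1 -> odd `|r|%N -> coprime `|r|%N 5 ->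
  prime p ->
  (2 * p%:Z + r = 0 %[mod 5])%Z ->
  5 - r <= 2 * p%:Z ->
  rat_congr p 4
    (\sum_(k < p) ((10 * k%:Z + r)%:~R * (poch (r%:~R / 5) k) ^+ 5
                     / (k`!)%:R ^+ 5))
    0.
Proof.
move=> r1 r_odd r5 p_pr rp pr.
have r5' : ~~ (5 %| `|r|)%N by rewrite -prime_coprime // coprime_sym.
have p1 := prime_gt1 p_pr.
have [p2|p_n2] := eqVneq p 2%N.
  (* For p = 2 the bound 5 - r <= 2p gives r >= 1. *)
  have -> : r = 1 by lia.
  apply: rat_congr0 => //; rewrite p2 !big_ord_recl big_ord0 /poch.
  rewrite !big_ord_recl !big_ord0 /=.
  have -> : (10 * 0%:Z + 1)%:~R = 1 :> rat by [].
  have -> : (10 * (bump 0 0)%:Z + 1)%:~R = 11 :> rat by [].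
  have [-> ->] : 0`! = 1%N /\ (bump 0 0)`! = 1%N by [].
  (* The sum is 1 + 11/5^5 = 3136/3125, and 3136 = 16 * 196. *)
  rewrite (_ : _ / _ = 196%:~R / 3125%:R); last by field.
  exact: p_integral_frac.
have p_odd : odd p by apply: contraT => p_even; move: (even_prime p_pr); lia.
have p_n5 : p != 5 by apply/eqP => p5; lia.
(* 3p - r = 5p - (2p + r) is a multiple of 5, positive since r <= 1. *)
have [n nE] : exists n : nat, (3 * p%:Z - r = 5 * n%:Z)%R.
  by exists `|((3 * p%:Z - r) %/ 5)%Z|%N; lia.
pose h := (p - n.+1)./2.
have n_even : ~~ odd n by lia.
(* p - n = (2p + r)/5 is odd, and it is positive because 5 - r <= 2p. *)
have pE : p = (n + (2 * h).+1)%N by rewrite /h; lia.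
(* As 10h = 2p + r - 5, this amounts to 5r < 15, which follows from r <= 1. *)
have hn : (3 * h < n)%N by lia.
pose A : rat := r%:~R / 5.
have AE : 5 * A + 5 * n%:R = 3 * p%:R :> rat.
  have := congr1 (fun z : int => z%:~R : rat) nE.
  by rewrite intrD intrN !intrM -!pmulrn /A => e; rewrite -e; field.
(* A zero would make r = -5j a multiple of 5. *)
have A0 (j : nat) : A + j%:R != 0.
  apply/eqP => e; have : (r + 5 * j%:Z)%:~R = 0 :> rat.
    by rewrite intrD intrM -pmulrn -[RHS](mulr0 5) -e /A; field.
  by move/eqP; rewrite intr_eq0 => /eqP; lia.
apply: rat_congr0 => //.
have full := full_sum_integral p n h A p_pr p_n5 n_even pE hn AE A0.
rewrite (_ : \sum_(k < p) _ = 5 * \sum_(k < p) (A + (2 * k)%:R) * wp A 0 k ^+ 5).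
  by rewrite -mulrA; apply: rpredM => //; p_int.
rewrite mulr_sumr; apply: eq_bigr => k _.
rewrite /wp addr0 subr0 poch1 expr_div_n intrD intrM -pmulrn natrM /A.
by field; rewrite pnatr_eq0 -lt0n fact_gt0.
Qed.
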